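(* Let $d>1$ be an integer and let $A=\{z\in\mathbb{C}:0<|z|<1\}$ be the punctured unit disc. The map $p_d:A\to A$, $p_d(z)=z^d$, is not $C^0_W(A)$-stable.
   Context: Let $Cov(A)$ be the space of covering maps $A\to A$, endowed with the Whitney (strong) $C^0$ topology: for $f\in Cov(A)$ and a continuous function $\epsilon:A\to(0,\infty)$, the $\epsilon$-neighborhood of $f$ is $\mathcal{N}_\epsilon(f)=\{g\in Cov(A): \mathrm{dist}(g(x),f(x))<\epsilon(x)\ \forall x\in A\}$, where $\mathrm{dist}$ is the Euclidean distance. A map $f\in Cov(A)$ is $C^0_W(A)$-stable if there exists such a neighborhood of $f$ in which every map $g$ is conjugate to $f$, i.e. there is a homeomorphism $\psi$ of $A$ with $\psi f=g\psi$. *)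

(* Defs.v *)
From HB Require Import structures.
From mathcomp Require Import all_boot all_order all_algebra.
From mathcomp Require Import all_classical all_reals all_analysis.
From mathcomp Require Export complex.
Set Implicit Arguments.
Unset Strict Implicit.
Unset Printing Implicit Defensive.
Import Order.TTheory GRing.Theory Num.Theory.
Import numFieldNormedType.Exports.
Local Open Scope classical_set_scope.
Local Open Scope ring_scope.
Local Open Scope complex_scope.

Definition homeo_on (X Y : topologicalType) (U : set X) (V : set Y)
    (f : X -> Y) : Prop :=
  [/\ {within U, continuous f}, set_bij U V f &
      exists g : Y -> X, {within V, continuous g} /\
                         (forall x, U x -> g (f x) = x)].

Definition homeomorphism (X Y : topologicalType) (f : X -> Y) : Prop :=
  continuous f /\
  exists g : Y -> X, [/\ continuous g, cancel f g & cancel g f].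

(* [S] is the set of sheets of [f] over [V]. *)
Definition evenly_covered (X Y : topologicalType) (f : X -> Y) (V : set Y) :
    Prop :=
  exists S : set (set X),
    [/\ forall U, S U -> open U /\ homeo_on U V f,
        trivIset S id &
        f @^-1` V = \bigcup_(U in S) U].

Definition covering_map (X Y : topologicalType) (f : X -> Y) : Prop :=
  [/\ continuous f,
      set_surj [set: X] [set: Y] f &
      forall y : Y, exists V : set Y, open_nbhs y V /\ evenly_covered f V].

(* The alias [^o] carries the topology of [R[i]] given by the complex modulus,
   i.e. the Euclidean topology of the plane.  [`|z|] lives in [R[i]]; it is a
   nonnegative real there, and the (partial) order of [R[i]] extends that of
   the reals. *)
Definition punctured_disc (R : realType) : set (R[i])^o :=
  [set z | 0 < `|z| < 1].

Arguments punctured_disc R : clear implicits.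

(* [annulus R] is a type, topologised as a subspace of the plane. *)
Notation annulus R := (set_type (punctured_disc R)).

Definition Cov (R : realType) : set (annulus R -> annulus R) :=
  [set f | covering_map f].

Arguments Cov R : clear implicits.

Definition whitney_nbhd (R : realType) (f : annulus R -> annulus R)
    (eps : annulus R -> R) : set (annulus R -> annulus R) :=
  [set g | Cov R g /\
           forall x, `|set_val (g x) - set_val (f x)| < (eps x)%:C].

Definition conjugate_to (X : topologicalType) (f g : X -> X) : Prop :=
  exists psi : X -> X, homeomorphism psi /\ psi \o f = g \o psi.

(* Meant for [f] in [Cov R]; the condition [g] in [Cov R] is part of
   [whitney_nbhd]. *)
Definition C0W_stable (R : realType) (f : annulus R -> annulus R) : Prop :=
  exists eps : annulus R -> R,
    [/\ continuous eps,
        forall x, 0 < eps x &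
        forall g, whitney_nbhd f eps g -> conjugate_to f g].

Lemma power_map_subproof (R : realType) (d : nat) (hd : (1 < d)%N)
    (z : annulus R) : (set_val z ^+ d : (R[i])^o) \in punctured_disc R.
Proof.
apply/mem_set; have [z0 z1] := andP (set_valP z).
have zp := normrX d (set_val z : R[i]).
rewrite /punctured_disc /=; apply/andP; split.
  by rewrite [ltRHS]zp exprn_gt0.
by rewrite [ltLHS]zp exprn_ilt1 // ?ltW // -lt0n ltnW.
Qed.

Definition power_map (R : realType) (d : nat) (hd : (1 < d)%N)
    (z : annulus R) : annulus R :=
  exist _ (set_val z ^+ d : (R[i])^o) (power_map_subproof hd z).

(* Main.v *)
Require Import Defs.
From mathcomp Require Import all_boot all_order all_algebra.
From mathcomp Require Import all_classical all_reals all_analysis.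
From mathcomp Require Import ring lra.

(* Given [eps], take the orbit c_n of 1/2 under p : z |-> z^d and small disjoint
   discs D_n around the c_n, and let g = p o h where the homeomorphism h of A is
   supported in the discs and contracts D_n so strongly around c_n that g maps
   the disc of half radius around c_n into the one around c_(n+1), injectively.
   How small D_n has to be for g to be [eps]-close to p only depends on [eps]
   near c_n.  All iterates of g are then injective on one and the same open set,
   whereas the fibers of the iterates of p accumulate at every point, because
   of the d^k-th roots of unity; so p and g are not conjugate. *)

Set Implicit Arguments.
Unset Strict Implicit.
Unset Printing Implicit Defensive.
Import Order.TTheory GRing.Theory Num.Theory.
Import numFieldNormedType.Exports.
Import Normc.
Local Open Scope classical_set_scope.
Local Open Scope ring_scope.
Local Open Scope complex_scope.

(** * The real-valued modulus on the complex plane *)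

Section Modulus.
Variable R : realType.
Implicit Types z w : R[i].

Lemma normrE_normc z : `|z| = (normc z)%:C.
Proof. by case: z. Qed.

Lemma normc_ge0 z : 0 <= normc z.
Proof. by rewrite -ler0c -normrE_normc. Qed.

Lemma normc_gt0 z : (0 < normc z) = (z != 0).
Proof. by rewrite -ltcR -normrE_normc normr_gt0. Qed.

Lemma normcX z n : normc (z ^+ n) = normc z ^+ n.
Proof.
by elim: n => [|n IH]; rewrite ?expr0 ?normc1 // !exprS normcM IH.
Qed.

Lemma normc_real (x : R) : normc x%:C = `|x|.
Proof. by rewrite /= expr0n addr0 sqrtr_sqr. Qed.

Lemma normcB z w : normc (z - w) = normc (w - z).
Proof. by rewrite -normcN opprB. Qed.

Lemma normc_triangle z w u : normc (z - u) <= normc (z - w) + normc (w - u).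
Proof. by apply: le_trans (le_normcD _ _); rewrite addrA subrK. Qed.

Lemma normc_le_sub z w : normc z <= normc w + normc (z - w).
Proof. by apply: le_trans (le_normcD _ _); rewrite addrC subrK. Qed.

Lemma nbhs_planeP (z : (R[i])^o) (B : set (R[i])^o) :
  nbhs z B <-> exists2 e : R, 0 < e & forall w, normc (w - z) < e -> B w.
Proof.
split.
  move=> /(proj1 (nbhs_normP z B))[e /= e0 eB].
  (* Radii of balls live in [R[i]]; positivity forces them to be real. *)
  have /complex_realP[k ek] := gtr0_real e0.
  exists k; first by move: e0; rewrite ek ltcR.
  move=> w wz; apply: eB => /=; rewrite ek.
  by rewrite -[ltLHS]/(`|(z : R[i]) - w|) normrE_normc ltcR normcB.
case=> e e0 eB; apply: (proj2 (nbhs_normP z B)).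
exists e%:C => /=; first by rewrite ltcR.
move=> w /= zw; apply: eB; rewrite normcB -ltcR -normrE_normc; exact: zw.
Qed.

End Modulus.

(** * The Euclidean distance on the punctured disc *)

Section Annulus.
Variable R : realType.
Local Notation A := (annulus R).
Implicit Types x y : A.

Definition dst x y : R := normc (set_val x - set_val y : R[i]).

Lemma dst_triangle y x z : dst x z <= dst x y + dst y z.
Proof. exact: normc_triangle. Qed.

Lemma dstC x y : dst x y = dst y x.
Proof. exact: normcB. Qed.

Lemma dst_ge0 x y : 0 <= dst x y.
Proof. exact: normc_ge0. Qed.

Lemma dstxx x : dst x x = 0.
Proof. by rewrite /dst subrr normc0. Qed.

Lemma set_val_inj : injective (set_val : A -> (R[i])^o).
Proof. by move=> [x px] [y py] /= ?; apply/eq_sig_hprop. Qed.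

Lemma dst_eq0 x y : dst x y = 0 -> x = y.
Proof. by move=> /eq0_normc /eqP; rewrite subr_eq0 => /eqP/set_val_inj. Qed.

Lemma nbhs_annulusP x (W : set A) :
  nbhs x W <-> exists2 e : R, 0 < e & forall y, dst y x < e -> W y.
Proof.
split.
  rewrite nbhsE => -[_ [[B oB <-] /= Bx] BW].
  have /nbhs_planeP[e e0 eB] : nbhs (set_val x) B by apply: open_nbhs_nbhs.
  by exists e => // y /eB; exact: BW.
case=> e e0 eW.
have : nbhs (set_val x) [set w : (R[i])^o | normc (w - set_val x : R[i]) < e].
  by apply/nbhs_planeP; exists e.
rewrite nbhsE => -[B [oB Bx] Be].
rewrite nbhsE; exists (set_val @^-1` B); first by split=> //; exists B.
by move=> y /= By; apply: eW; apply: Be.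
Qed.

Lemma annulusP (z : R[i]) : 0 < normc z < 1 -> exists x : A, set_val x = z.
Proof.
move=> h; have zA : (z : (R[i])^o) \in punctured_disc R.
  by apply/mem_set; rewrite /punctured_disc /=
    -[`|_|]/(`|z : R[i]|) normrE_normc !ltcR.
by exists (exist _ (z : (R[i])^o) zA).
Qed.

Lemma normc_annulus x : 0 < normc (set_val x : R[i]) < 1.
Proof.
have := set_valP x; rewrite /punctured_disc /= -[`|_|]/(`|set_val x : R[i]|).
by rewrite normrE_normc !ltcR.
Qed.

End Annulus.

(** * Continuity and openness in terms of [dst] *)

Section AnnulusContinuity.
Variable R : realType.
Local Notation A := (annulus R).
Implicit Types x y : A.

Lemma cvg_annulusP (f : A -> A) x :
  f @ x --> f x <-> forall e : R, 0 < e ->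
    exists2 r : R, 0 < r & forall y, dst y x < r -> dst (f y) (f x) < e.
Proof.
split=> [fx e e0|fx W /nbhs_annulusP[e e0 eW]].
  have /fx/nbhs_annulusP[r r0 rP] : nbhs (f x) [set y | dst y (f x) < e].
    by apply/nbhs_annulusP; exists e.
  by exists r.
have [r r0 rP] := fx e e0.
by apply/nbhs_annulusP; exists r => // y /rP/eW.
Qed.

Lemma continuous_annulus_real (f : A -> R) x (e : R) :
  {for x, continuous f} -> 0 < e ->
  exists2 r : R, 0 < r & forall y, dst y x < r -> `|f x - f y| < e.
Proof.
move=> fx e0; have /fx/nbhs_annulusP : nbhs (f x) (ball (f x) e).
  exact: nbhsx_ballx.
by case=> r r0 rP; exists r.
Qed.

Lemma open_annulusP (W : set A) :
  open W <-> forall x, W x ->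
    exists2 e : R, 0 < e & forall y, dst y x < e -> W y.
Proof.
rewrite openE; split=> [oW x /oW /nbhs_annulusP//|oW x Wx].
exact/nbhs_annulusP/oW.
Qed.

Lemma open_dst x (e : R) : open [set y | dst y x < e].
Proof.
apply/open_annulusP => y /= yx; exists (e - dst y x); first by rewrite subr_gt0.
by move=> z zy; have := dst_triangle y z x; lra.
Qed.

End AnnulusContinuity.

(** * Upper and lower Lipschitz bounds for powers, and roots near a point *)

Section PowerEstimates.
Variable R : realType.
Implicit Types z w v a b : R[i].

Lemma normc_exp_le1 z n : normc z <= 1 -> normc (z ^+ n) <= 1.
Proof. by move=> z1; rewrite normcX exprn_ile1 ?normc_ge0. Qed.

Lemma normc_subX_le z w n : normc z <= 1 -> normc w <= 1 ->
  normc (z ^+ n - w ^+ n) <= n%:R * normc (z - w).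
Proof.
move=> z1 w1; elim: n => [|n IH]; first by rewrite !expr0 subrr normc0 mul0r.
have -> : z ^+ n.+1 - w ^+ n.+1 = z * (z ^+ n - w ^+ n) + (z - w) * w ^+ n.
  by rewrite !exprS; ring.
apply: le_trans (le_normcD _ _) _; rewrite !normcM -natr1 mulrDl mul1r.
apply: lerD.
  by apply: le_trans IH; rewrite ler_piMl ?normc_ge0.
by rewrite ler_piMr ?normc_ge0 ?normc_exp_le1.
Qed.

Lemma normc_sum_le (I : Type) (r : seq I) (F : I -> R[i]) :
  normc (\sum_(i <- r) F i) <= \sum_(i <- r) normc (F i).
Proof.
elim: r => [|i r IH]; first by rewrite !big_nil normc0.
by rewrite !big_cons; apply: le_trans (le_normcD _ _) _; rewrite lerD2l.
Qed.

(* The constants come from [a^d - b^d = (a - b) * sum_(i < d) a^(d-1-i) b^i],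
   each term of the sum being within [(d - 1) rho] of [w^(d-1)]. *)
Lemma normc_subX_ge d w a b (rho : R) : (0 < d)%N ->
  normc w <= 1 -> normc a <= 1 -> normc b <= 1 ->
  rho = normc w ^+ d.-1 / (2 * d%:R) ->
  normc (a - w) <= rho -> normc (b - w) <= rho ->
  normc w ^+ d.-1 / 2 * normc (a - b) <= normc (a ^+ d - b ^+ d).
Proof.
(* From here on [d] is the original exponent minus one. *)
case: d => // d _ w1 a1 b1 rhoE aw bw.
rewrite subrXX normcM mulrC ler_wpM2l ?normc_ge0 //=.
set s := \sum_(i < d.+1) _.
have sw : normc (w ^+ d *+ d.+1 - s) <= d.+1%:R * (d%:R * rho).
  rewrite -[X in _ *+ X]card_ord -sumr_const /s -sumrB.
  apply: le_trans (normc_sum_le _ _) _.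
  rewrite mulr_natl -[X in _ *+ X]card_ord -sumr_const; apply: ler_sum => i _.
  have id : (i <= d)%N by rewrite -ltnS.
  rewrite normcB -[in w ^+ d](subnK id) exprD.
  have -> : a ^+ (d - i) * b ^+ i - w ^+ (d - i) * w ^+ i =
      a ^+ (d - i) * (b ^+ i - w ^+ i) + (a ^+ (d - i) - w ^+ (d - i)) * w ^+ i.
    by ring.
  apply: le_trans (le_normcD _ _) _; rewrite !normcM.
  (* The two terms contribute at most [i * rho] and [(d - i) * rho]. *)
  rewrite -[in d%:R](subnK id) natrD mulrDl addrC lerD //.
    apply: (@le_trans _ _ (normc (a ^+ (d - i) - w ^+ (d - i)))).
      by rewrite ler_piMr ?normc_ge0 ?normc_exp_le1.
    by apply: le_trans (normc_subX_le _ _ _) _ => //; rewrite ler_wpM2l.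
  apply: (@le_trans _ _ (normc (b ^+ i - w ^+ i))).
    by rewrite ler_piMl ?normc_ge0 ?normc_exp_le1.
  by apply: le_trans (normc_subX_le _ _ _) _ => //; rewrite ler_wpM2l.
have := normc_le_sub (w ^+ d *+ d.+1) s.
move: sw; rewrite normcMn normcX.
set e := normc (_ - s); set m := normc w ^+ d in rhoE *.
have m0 : 0 <= m by rewrite exprn_ge0 ?normc_ge0.
(* By the choice of [rho] the error is at most [d * m / 2], so [s] keeps modulus at least
   [(d + 1) * m - d * m / 2]. *)
have -> : d.+1%:R * (d%:R * rho) = d%:R * m / 2 :> R.
  have : d.+1%:R != 0 :> R by rewrite pnatr_eq0.
  by rewrite rhoE /=; move: d.+1%:R => k k0; field.
have : 0 <= d%:R * m by rewrite mulr_ge0.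
rewrite -[m *+ _]mulr_natl -(natr1 d) mulrDl mul1r; lra.
Qed.

(** The modulus of [w^d - v] is the product of the distances from [w] to the [d] roots of [X^d - v];
    if each were at least [rho], the product would be at least [rho^d]. *)
Lemma exists_close_root d v w (rho : R) : (0 < d)%N -> 0 <= rho ->
  normc (w ^+ d - v) < rho ^+ d -> exists2 z, z ^+ d = v & normc (w - z) < rho.
Proof.
move=> d0 rho0 h.
have [r rE] := closed_field_poly_normal ('X^d - v%:P).
have mon : 'X^d - v%:P \is monic by rewrite monicXnsubC.
rewrite (monicP mon) scale1r in rE.
have sr : size r = d.
  by have := size_prod_XsubC r id; rewrite -rE size_XnsubC // => -[].
have [/hasP[z zr zw]|] := boolP (has (fun z => normc (w - z) < rho) r).
  exists z => //; have : root ('X^d - v%:P) z by rewrite rE root_prod_XsubC.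
  by rewrite rootE !hornerE subr_eq0 => /eqP.
move=> /hasPn far; move: h.
have -> : w ^+ d - v = ('X^d - v%:P).[w] by rewrite !hornerE.
rewrite rE horner_prod -sr ltNge => /negP[].
elim: r far {rE sr} => [|z r IH] far; first by rewrite big_nil normc1.
rewrite big_cons normcM exprS /= ler_pM ?exprn_ge0 //.
  by rewrite hornerXsubC leNgt far // mem_head.
by apply: IH => u ur; rewrite far // in_cons ur orbT.
Qed.

End PowerEstimates.

(** * The power map is a covering *)

Section PowerMap.
Variables (R : realType) (d : nat) (hd : (1 < d)%N).
Local Notation A := (annulus R).
Local Notation p := (@power_map R d hd).
Implicit Types x y z w : A.

Let d0 : (0 < d)%N. Proof. exact: ltnW. Qed.

Lemma normc_annulus_le1 x : normc (set_val x : R[i]) <= 1.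
Proof. by have /andP[_ /ltW] := normc_annulus x. Qed.

Lemma normc_annulus_gt0 x : 0 < normc (set_val x : R[i]).
Proof. by have /andP[] := normc_annulus x. Qed.

Lemma val_power_map x : set_val (p x) = (set_val x : R[i]) ^+ d.
Proof. by []. Qed.

Lemma dst_power_map_le x y : dst (p x) (p y) <= d%:R * dst x y.
Proof. exact: normc_subX_le (normc_annulus_le1 x) (normc_annulus_le1 y). Qed.

(** The radius [rho] of [normc_subX_ge]. It depends only on the modulus of [w], hence is constant on
    the fibers of [p]. *)
Definition inj_radius w : R := normc (set_val w : R[i]) ^+ d.-1 / (2 * d%:R).

Lemma inj_radius_gt0 w : 0 < inj_radius w.
Proof.
rewrite divr_gt0 //; first by apply: exprn_gt0; exact: normc_annulus_gt0.
by rewrite mulr_gt0 // ltr0n.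
Qed.

Lemma dst_power_map_ge w x y : dst x w <= inj_radius w ->
  dst y w <= inj_radius w -> d%:R * inj_radius w * dst x y <= dst (p x) (p y).
Proof.
move=> xw yw.
have := normc_subX_ge d0 (normc_annulus_le1 w) (normc_annulus_le1 x)
  (normc_annulus_le1 y) erefl xw yw.
apply: le_trans; rewrite le_eqVlt; apply/orP; left; apply/eqP.
have : d%:R != 0 :> R by rewrite pnatr_eq0 -lt0n.
by rewrite /inj_radius; move: (d%:R) => k k0; rewrite /dst; field.
Qed.

Lemma power_map_inj_on w x y : dst x w <= inj_radius w ->
  dst y w <= inj_radius w -> p x = p y -> x = y.
Proof.
move=> xw yw pxy; have := dst_power_map_ge xw yw; rewrite pxy dstxx.
have k0 : 0 < d%:R * inj_radius w.
  by apply: mulr_gt0; rewrite ?ltr0n //; exact: inj_radius_gt0.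
rewrite pmulr_rle0 // => xy.
by apply/dst_eq0/le_anti; rewrite xy dst_ge0.
Qed.

Lemma continuous_power_map : continuous p.
Proof.
move=> x; apply/cvg_annulusP => e e0.
have dR : 0 < d%:R :> R by rewrite ltr0n.
exists (e / d%:R) => [|y yx]; first by rewrite divr_gt0.
apply: le_lt_trans (dst_power_map_le _ _) _.
by rewrite mulrC -ltr_pdivlMr.
Qed.

Lemma power_map_root v (z : R[i]) : z ^+ d = set_val v ->
  exists2 x, set_val x = z & p x = v.
Proof.
move=> zv; have [|x xz] := @annulusP R z.
  have := normc_annulus v; rewrite -zv normcX => /andP[z0 z1].
  apply/andP; split.
    rewrite normc_gt0; apply: contraTneq z0 => ->.
    by rewrite normc0 expr0n eqn0Ngt d0 ltxx.
  by rewrite ltNge; apply: contraTN z1 => z1; rewrite -leNgt exprn_ege1.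
exists x => //; apply: set_val_inj; rewrite val_power_map xz; exact: zv.
Qed.

Lemma power_map_close_root v w (rho : R) : 0 <= rho ->
  dst (p w) v < rho ^+ d -> exists2 x, p x = v & dst w x < rho.
Proof.
move=> rho0 /(exists_close_root d0 rho0)[z zv wz].
by have [x xz xv] := power_map_root zv; exists x => //; rewrite /dst xz.
Qed.

Lemma power_map_surj v : exists x, p x = v.
Proof.
(* With [w = 0] and [rho = 1] the closeness condition just says that [v] has modulus less than 1. *)
have [|z zv _] := @exists_close_root R d (set_val v) 0 1 d0 ler01.
  rewrite expr0n eqn0Ngt d0 sub0r normcN expr1n.
  by case/andP: (normc_annulus v).
by have [x _ xv] := power_map_root zv; exists x.
Qed.

Lemma inj_radius_fiber w z : p w = p z -> inj_radius w = inj_radius z.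
Proof.
move=> /(congr1 (fun x => normc (set_val x : R[i]))).
rewrite !val_power_map !normcX => wz; congr (_ ^+ _ / _); apply/eqP.
by rewrite -(@eqrXn2 _ d) ?normc_ge0 //; apply/eqP.
Qed.

(** The sheets over a small disc [V] around [y] are cut out by discs around the points of the fiber:
    [power_map_close_root] makes [p] onto [V] on each of them, and [dst_power_map_ge] makes it
    injective with Lipschitz inverse. *)
Lemma covering_power_map : covering_map p.
Proof.
split; first exact: continuous_power_map.
  by move=> v _; have [x xv] := power_map_surj v; exists x.
move=> y; have [w0 w0y] := power_map_surj y.
(* Half of the injectivity radius common to the whole fiber; the factor 2 is what makes the sheets
   disjoint. *)
pose r := inj_radius w0 / 2; have r0 : 0 < r.
  by apply: divr_gt0 => //; exact: inj_radius_gt0.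
have rad w : p w = y -> inj_radius w = 2 * r.
  by rewrite -w0y => /inj_radius_fiber ->; rewrite /r; lra.
pose V := [set v | dst v y < r ^+ d].
have oV : open V by exact: open_dst.
exists V; split; first by split=> //; rewrite /V /= dstxx exprn_gt0.
pose sheet w := [set z | dst z w < r] `&` p @^-1` V.
exists [set sheet w | w in [set w | p w = y]]; split.
- move=> _ [w /= wy <-]; split.
    apply: openI; first exact: open_dst.
    by apply: open_comp => // x _; exact: continuous_power_map.
  have inj_sheet z z' : sheet w z -> sheet w z' -> p z = p z' -> z = z'.
    move=> [zw _] [z'w _]; apply: (@power_map_inj_on w); rewrite rad //.
      by move: zw => /=; lra.
    by move: z'w => /=; lra.
  have surj_sheet v : V v -> exists2 z, sheet w z & p z = v.
    move=> Vv; have [||z zv wz] := @power_map_close_root v w r.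
    + exact: ltW.
    + by rewrite wy dstC.
    + by exists z => //; split; rewrite /= ?zv // dstC.
  (* The default [w0] is only taken outside [V], where the inverse is not constrained. *)
  pose g v := xget w0 [set z | sheet w z /\ p z = v].
  have gP v : V v -> sheet w (g v) /\ p (g v) = v.
    move=> /surj_sheet[z sz zv].
    by apply: (@xgetPex _ w0 [set z | sheet w z /\ p z = v]); exists z.
  split.
  + by apply: continuous_subspaceT => x; exact: continuous_power_map.
  + split=> [z []//|z z' /set_mem sz /set_mem sz'|v /surj_sheet[z sz zv]].
      exact: inj_sheet.
    by exists z.
  + exists g; split; last first.
      move=> z sz; have [_ Vz] := sz; have [sgz pgz] := gP _ Vz.
      exact: inj_sheet.
    rewrite continuous_open_subspace // => v /set_mem Vv.
    apply/cvg_annulusP => e e0.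
    have [e' e'0 e'V] := (open_annulusP V).1 oV v Vv.
    (* The expansion constant of [dst_power_map_ge] on the sheet; its inverse is a Lipschitz
       constant of [g]. The radius [e'] keeps [u] in [V]. *)
    have k0 : 0 < d%:R * (2 * r).
      by apply: mulr_gt0; rewrite ?ltr0n // pmulr_rgt0.
    exists (Num.min e' (d%:R * (2 * r) * e)).
      by rewrite lt_min e'0 pmulr_rgt0.
    move=> u; rewrite lt_min => /andP[/e'V Vu uv].
    have [[gvw _] pgv] := gP _ Vv; have [[guw _] pgu] := gP _ Vu.
    have := @dst_power_map_ge w (g u) (g v); rewrite rad // pgu pgv => h.
    rewrite -(ltr_pM2l k0); apply: le_lt_trans uv; apply: h.
      by move: guw => /=; lra.
    by move: gvw => /=; lra.
- move=> _ _ [w /= wy <-] [w' /= w'y <-] [z [[/= zw _] [/= zw' _]]].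
  (* Centres of overlapping sheets are less than [2 * r] apart, so they lie in one disc of
     injectivity, and they have the same image [y]. *)
  suff -> : w = w' by [].
  apply: (@power_map_inj_on w); rewrite ?rad //; last by rewrite wy w'y.
    by rewrite dstxx; lra.
  by have := dst_triangle z w' w; rewrite (dstC w' z); lra.
- apply/seteqP; split=> [z Vz|z [_ [w _ <-]] []//].
  have [||w wy wz] := @power_map_close_root y z r.
  + exact: ltW.
  + exact: Vz.
  + by exists (sheet w); first by exists w.
Qed.

End PowerMap.

(** Sheets are pulled back along [h], and the local inverses are followed by the inverse of [h]. *)
Lemma covering_map_comp_homeo (X Y : topologicalType) (f : X -> Y)
  (h : X -> X) : homeomorphism h -> covering_map f -> covering_map (f \o h).
Proof.
move=> [ch [k [ck hK kH]]] [cf sf ef]; split.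
- by move=> x; apply: continuous_comp; [exact: ch | exact: cf].
- by move=> y /sf[x _ xy]; exists (k x) => //=; rewrite kH.
move=> y; have [V [Vy [S [SV tS fV]]]] := ef y; exists V; split=> //.
exists [set h @^-1` U | U in S]; split.
- move=> _ [U SU <-]; have [oU [cU bU [g [cg gK]]]] := SV _ SU; split.
    by apply: open_comp => // x _; exact: ch.
  have [fun_f inj_f surj_f] := bU.
  split.
  + by apply: continuous_subspaceT => x; apply: continuous_comp;
      [exact: ch | exact: cf].
  + split=> [x Ux|x x' /set_mem Ux /set_mem Ux' fxx'|v /surj_f[u Uu uv]].
    * exact: fun_f.
    * by apply: (can_inj hK); apply: inj_f => //; exact/mem_set.
    * by exists (k u) => /=; rewrite kH.
  + exists (k \o g); split; last by move=> x Ux /=; rewrite gK.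
    move=> v; apply: (@continuous_comp (subspace V) X X g k v (cg v)).
    exact: ck.
- move=> _ _ [U SU <-] [U' SU' <-] [x [Ux U'x]].
  by congr (_ @^-1` _); apply: tS => //; exists (h x).
- rewrite comp_preimage fV; apply/seteqP; split=> x.
    by move=> [U SU Ux]; exists (h @^-1` U) => //; exists U.
  by move=> [_ [U SU <-] Ux]; exists U.
Qed.

(** * Pinching discs *)

Section Pinch.
Variable R : realType.
Implicit Types (s t u b : R) (z w c : R[i]).

Definition pinch_factor s t := s / (1 + (s - 1) * t).

(* On [0, 1], [t |-> pinch_factor s t * t] is the Moebius homeomorphism fixing
   0 and 1 with derivative [s] at 0; its inverse is the one of parameter
   [s^-1]. *)
Definition pinch c b s z : R[i] :=
  c + (pinch_factor s (Num.min 1 (normc (z - c) / b)))%:C * (z - c).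

(** The denominator is affine in [t], with values 1 and [s] at the ends of [0, 1]. *)
Lemma pinch_denom_ge s t : 0 < s -> 0 <= t <= 1 ->
  Num.min 1 s <= 1 + (s - 1) * t.
Proof.
by move=> s0 /andP[t0 t1]; rewrite ge_min; case: (lerP 1 s) => ?; nra.
Qed.

Lemma pinch_denom_gt0 s t : 0 < s -> 0 <= t <= 1 -> 0 < 1 + (s - 1) * t.
Proof.
by move=> s0 /(pinch_denom_ge s0); apply: lt_le_trans; rewrite lt_min ltr01.
Qed.

Lemma pinch_factor_gt0 s t : 0 < s -> 0 <= t <= 1 -> 0 < pinch_factor s t.
Proof. by move=> s0 t01; rewrite divr_gt0 ?pinch_denom_gt0. Qed.

Lemma pinch_factor_lipschitz s : 0 < s -> exists2 K, 0 < K &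
  forall t u, 0 <= t <= 1 -> 0 <= u <= 1 ->
    pinch_factor s t <= K /\
    `|pinch_factor s t - pinch_factor s u| <= K * `|t - u|.
Proof.
move=> s0; pose m := Num.min 1 s.
have m0 : 0 < m by rewrite lt_min ltr01.
(* The first summand bounds the factor, the second is a Lipschitz constant for it;
   [pinch_continuous] uses both bounds with a single [K]. *)
exists (s / m + s * `|s - 1| / (m * m)).
  by rewrite ltr_pwDl ?divr_gt0 // divr_ge0 ?mulr_ge0 // ltW.
move=> t u t01 u01.
have Dt := pinch_denom_gt0 s0 t01; have Du := pinch_denom_gt0 s0 u01.
have Dtm := pinch_denom_ge s0 t01; have Dum := pinch_denom_ge s0 u01.
split.
  rewrite -[leLHS]addr0 lerD //; last by rewrite divr_ge0 ?mulr_ge0 // ltW.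
  by rewrite ler_pM2l // lef_pV2.
have -> : pinch_factor s t - pinch_factor s u =
    s * (s - 1) / ((1 + (s - 1) * t) * (1 + (s - 1) * u)) * (u - t).
  by rewrite /pinch_factor; field; rewrite !gt_eqF.
rewrite normrM (distrC u) ler_wpM2r //.
apply: (@le_trans _ _ (s * `|s - 1| / (m * m))); last first.
  by rewrite -[leLHS]add0r lerD // divr_ge0 // ltW.
have DD : 0 < (1 + (s - 1) * t) * (1 + (s - 1) * u) by exact: mulr_gt0.
rewrite !normrM (gtr0_norm s0).
rewrite (@gtr0_norm _ (_ ^-1)) ?invr_gt0 //.
apply: ler_wpM2l; first by apply: mulr_ge0 => //; exact: ltW.
by rewrite lef_pV2 ?posrE ?mulr_gt0 // ler_pM // ltW.
Qed.

Lemma min1_lipschitz (x y : R) : `|Num.min 1 x - Num.min 1 y| <= `|x - y|.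
Proof.
have [x1|x1] := leP 1 x; have [y1|y1] := leP 1 y => //.
- by rewrite subrr normr0 normr_ge0.
- by rewrite (ger0_norm (_ : 0 <= 1 - y)); have := ler_norm (x - y); lra.
- by rewrite distrC (distrC x) (ger0_norm (_ : 0 <= 1 - x));
    have := ler_norm (y - x); lra.
Qed.

Section FixedDisc.
Variables (c : R[i]) (b : R).
Hypothesis b0 : 0 < b.

Let ratio z := Num.min 1 (normc (z - c) / b).

Let ratio01 z : 0 <= ratio z <= 1.
Proof.
rewrite /ratio le_min ler01 ge_min lexx andbT /=.
by apply: divr_ge0; [exact: normc_ge0 | exact: ltW].
Qed.

(** The truncated ratio is 1 there, and [pinch_factor s 1 = 1]. *)
Lemma pinch_out s z : 0 < s -> b <= normc (z - c) -> pinch c b s z = z.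
Proof.
move=> s0 zb; rewrite /pinch min_l ?ler_pdivlMr ?mul1r // /pinch_factor.
by rewrite mulr1 [1 + _]addrC subrK divff ?gt_eqF // mul1r addrC subrK.
Qed.

Lemma pinch_subr s z :
  pinch c b s z - c = (pinch_factor s (ratio z))%:C * (z - c).
Proof. by rewrite /pinch addrC addKr. Qed.

Lemma normc_pinch s z : 0 < s -> normc (pinch c b s z - c) =
  pinch_factor s (ratio z) * normc (z - c).
Proof.
by move=> s0; rewrite pinch_subr normcM normc_real gtr0_norm ?pinch_factor_gt0.
Qed.

Lemma ratio_in z : normc (z - c) < b ->
  ratio z = normc (z - c) / b /\ ratio z < 1.
Proof.
move=> zb; have h : normc (z - c) / b < 1 by rewrite ltr_pdivrMr ?mul1r.
by rewrite /ratio min_r ?ltW.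
Qed.

Lemma normc_pinch_in s z : 0 < s -> normc (z - c) < b ->
  normc (pinch c b s z - c) = b * (pinch_factor s (ratio z) * ratio z).
Proof.
move=> s0 /ratio_in[rE _]; rewrite normc_pinch //.
have -> : normc (z - c) = b * ratio z by rewrite rE; field; rewrite gt_eqF.
by ring.
Qed.

(** After clearing the denominator, [s * t < 1 + (s - 1) * t] is the same as [t < 1]. *)
Lemma moebius_lt1 s t : 0 < s -> 0 <= t < 1 -> 0 <= pinch_factor s t * t < 1.
Proof.
move=> s0 /andP[t0 t1]; have t01 : 0 <= t <= 1 by rewrite t0 ltW.
rewrite mulr_ge0 ?(ltW (pinch_factor_gt0 _ _)) //=.
by rewrite mulrAC ltr_pdivrMr ?pinch_denom_gt0 //; nra.
Qed.

Lemma pinch_in s z : 0 < s -> normc (z - c) < b ->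
  normc (pinch c b s z - c) < b.
Proof.
move=> s0 zb; rewrite normc_pinch_in // -[ltRHS]mulr1 ltr_pM2l //.
have [_ r1] := ratio_in zb; have /andP[r0 _] := ratio01 z.
by have /andP[] : 0 <= pinch_factor s (ratio z) * ratio z < 1
  by apply: moebius_lt1; rewrite ?r0.
Qed.

Lemma pinchK s : 0 < s -> cancel (pinch c b s) (pinch c b s^-1).
Proof.
move=> s0 z; have si0 : 0 < s^-1 by rewrite invr_gt0.
have [zb|zb] := leP b (normc (z - c)); first by rewrite !pinch_out.
have [_ r1] := ratio_in zb; have r01 := ratio01 z; have /andP[r0 _] := r01.
have [rE _] := ratio_in (pinch_in s0 zb).
rewrite normc_pinch_in // mulrAC divff ?gt_eqF // mul1r in rE.
rewrite {1}/pinch -/(ratio _) rE pinch_subr mulrA -rmorphM /=.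
have Dr := pinch_denom_gt0 s0 r01.
(* The denominator for [s^-1] at the image ratio is the inverse of the one for [s] at the ratio of
   [z], so the two factors multiply to 1. *)
have DE : 1 + (s^-1 - 1) * (pinch_factor s (ratio z) * ratio z) =
    (1 + (s - 1) * ratio z)^-1.
  by rewrite /pinch_factor; field; rewrite !gt_eqF.
have -> : pinch_factor s^-1 (pinch_factor s (ratio z) * ratio z) *
    pinch_factor s (ratio z) = 1.
  by rewrite {1}/pinch_factor DE invrK /pinch_factor; field; rewrite !gt_eqF.
by rewrite rmorph1 mul1r addrC subrK.
Qed.

(** On the half disc the ratio is below 1/2, so the denominator is at least 1/2 and the factor at
    most [2 * s]. *)
Lemma pinch_half s z : 0 < s <= 1 -> normc (z - c) < b / 2 ->
  normc (pinch c b s z - c) <= 2 * s * normc (z - c).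
Proof.
move=> /andP[s0 s1] zb; rewrite normc_pinch // ler_wpM2r ?normc_ge0 //.
have zb' : normc (z - c) < b by move: zb b0; lra.
have [rE _] := ratio_in zb'.
have r12 : ratio z < 1 / 2 by rewrite rE ltr_pdivrMr //; move: zb; lra.
have r01 := ratio01 z; rewrite ler_pdivrMr ?pinch_denom_gt0 //.
have /andP[r0 _] := r01.
have : (1 - s) * ratio z <= 1 * ratio z by rewrite ler_wpM2r //; lra.
rewrite mul1r => h; rewrite -[leLHS]mulr1 -mulrA mulrCA ler_pM2l //.
by move: h r12; rewrite !mulrBl mul1r; lra.
Qed.

Lemma pinch_continuous s z (e : R) : 0 < s -> 0 < e -> exists2 r, 0 < r &
  forall w, normc (w - z) < r -> normc (pinch c b s w - pinch c b s z) < e.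
Proof.
move=> s0 e0; have [K K0 KP] := pinch_factor_lipschitz s0.
(* The first term comes from moving the point under a fixed factor, the second from the variation of
   the factor, applied to [z - c]. *)
pose L := K + K / b * normc (z - c).
have L0 : 0 < L by rewrite ltr_wpDr // mulr_ge0 ?normc_ge0 ?ltW ?divr_gt0.
exists (e / L) => [|w]; first by rewrite divr_gt0.
rewrite ltr_pdivlMr // => we; apply: le_lt_trans we.
have -> : pinch c b s w - pinch c b s z =
    (pinch_factor s (ratio w))%:C * (w - z) +
    (pinch_factor s (ratio w) - pinch_factor s (ratio z))%:C * (z - c).
  by rewrite /pinch -/(ratio w) -/(ratio z) rmorphB /=; ring.
apply: le_trans (le_normcD _ _) _; rewrite !normcM !normc_real.
have [kw kwz] := KP _ _ (ratio01 w) (ratio01 z).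
rewrite (gtr0_norm (pinch_factor_gt0 s0 (ratio01 w))) /L mulrDr lerD //.
  by rewrite mulrC ler_wpM2l ?normc_ge0.
rewrite mulrA ler_wpM2r ?normc_ge0 //; apply: le_trans kwz _.
rewrite mulrCA ler_pM2l // ler_pdivlMr //.
have rlip : `|ratio w - ratio z| <= `|normc (w - c) / b - normc (z - c) / b|.
  exact: min1_lipschitz.
rewrite -mulrBl normrM (gtr0_norm (_ : 0 < b^-1)) ?invr_gt0 // in rlip.
rewrite ler_pdivlMr // in rlip.
apply: le_trans rlip _.
have := normc_triangle w z c; have := normc_triangle z w c.
by rewrite (normcB z w) ler_norml; lra.
Qed.

End FixedDisc.
End Pinch.

(** * Gluing pinches over a locally finite family of disjoint discs *)

Section Glue.
Variables (R : realType) (c : nat -> annulus R) (b : nat -> R).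
Local Notation A := (annulus R).
Implicit Types (x y : A) (s : nat -> R).

Definition in_disc n x := dst x (c n) < b n.

(** The default 0 is harmless: outside all discs every pinch is the identity. *)
Definition disc_index x : nat := xget 0%N [set n | in_disc n x].

Definition glued_pinch s x : A :=
  let n := disc_index x in
  insubd x (pinch (set_val (c n)) (b n) (s n) (set_val x) : (R[i])^o).

Hypothesis b_gt0 : forall n, 0 < b n.
Hypothesis disc_sub : forall n (z : R[i]),
  normc (z - set_val (c n)) < b n -> 0 < normc z < 1.
(** For [y = z] this is disjointness; with two points it makes the glued map agree near [x] with a
    single pinch, which gives continuity. *)
Hypothesis locally_one_disc : forall x, exists2 r : R, 0 < r &
  forall n m y z, dst y x < r -> dst z x < r -> in_disc n y -> in_disc m z ->
  n = m.

Lemma in_disc_inj n m x : in_disc n x -> in_disc m x -> n = m.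
Proof.
have [r r0 rP] := locally_one_disc x.
by apply: rP; rewrite dstxx.
Qed.

Lemma disc_indexE n x : in_disc n x -> disc_index x = n.
Proof.
move=> xn; apply: (in_disc_inj _ xn).
by apply: (@xgetPex _ 0%N [set n | in_disc n x]); exists n.
Qed.

Lemma in_disc_dec x : (exists n, in_disc n x) \/ (forall n, ~ in_disc n x).
Proof.
have [|h] := pselect (exists n, in_disc n x); [by left | right => n xn].
by apply: h; exists n.
Qed.

Section Param.
Variable s : nat -> R.
Hypothesis s_gt0 : forall n, 0 < s n.

(** The premise also admits a point outside all discs, where any [n] will do; so one [n] serves a
    whole neighbourhood in [continuous_glued_pinch]. The default of [insubd] is never taken, since a
    pinch preserves its disc, which lies in the annulus. *)
Lemma val_glued_pinch n x : (forall m, in_disc m x -> m = n) ->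
  set_val (glued_pinch s x) = pinch (set_val (c n)) (b n) (s n) (set_val x).
Proof.
move=> xn; have pA : forall m, (pinch (set_val (c m)) (b m) (s m) (set_val x) :
    (R[i])^o) \in punctured_disc R.
  move=> m; have [xm|xm] := leP (b m) (dst x (c m)).
    by rewrite pinch_out //; case: x {xn xm}.
  have /disc_sub := pinch_in (b_gt0 m) (s_gt0 m) xm => /annulusP[y <-].
  by case: y.
rewrite /glued_pinch /=.
transitivity (pinch (set_val (c (disc_index x))) (b (disc_index x))
    (s (disc_index x)) (set_val x)).
  by rewrite [LHS](insubdK _ (pA _)).
have [[m xm]|xout] := in_disc_dec x.
  by rewrite (disc_indexE xm) (xn _ xm).
by rewrite !pinch_out // leNgt; apply/negP; exact: xout.
Qed.

Lemma glued_pinchE n x : in_disc n x ->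
  set_val (glued_pinch s x) = pinch (set_val (c n)) (b n) (s n) (set_val x).
Proof. by move=> xn; apply: val_glued_pinch => m /in_disc_inj; exact. Qed.

Lemma glued_pinch_in n x : in_disc n x -> in_disc n (glued_pinch s x).
Proof. by move=> xn; rewrite /in_disc /dst (glued_pinchE xn) pinch_in. Qed.

Lemma glued_pinch_out x : (forall n, ~ in_disc n x) -> glued_pinch s x = x.
Proof.
move=> xout; apply: set_val_inj; rewrite (@val_glued_pinch 0) => [|m /xout//].
by rewrite pinch_out // leNgt; apply/negP; exact: xout.
Qed.

Lemma continuous_glued_pinch : continuous (glued_pinch s).
Proof.
move=> x; have [r r0 rP] := locally_one_disc x.
have [n nP] : exists n, forall y, dst y x < r -> forall m, in_disc m y -> m = n.
  have [[n [y [yx yn]]]|h] :=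
      pselect (exists n, exists y, dst y x < r /\ in_disc n y).
    by exists n => z zx m zm; exact: rP zm yn.
  by exists 0%N => y yx m ym; case: h; exists m, y.
apply/cvg_annulusP => e e0.
have [r' r'0 r'P] :=
  pinch_continuous (set_val (c n)) (b_gt0 n) (set_val x) (s_gt0 n) e0.
exists (Num.min r r') => [|y]; first by rewrite lt_min r0.
rewrite lt_min => /andP[yr yr'].
rewrite /dst (val_glued_pinch (nP _ yr)) (@val_glued_pinch n x).
  exact: r'P.
by apply: nP; rewrite dstxx.
Qed.

End Param.

Lemma glued_pinchK s : (forall n, 0 < s n) ->
  cancel (glued_pinch s) (glued_pinch (fun n => (s n)^-1)).
Proof.
move=> s0 x; have s0' n : 0 < (s n)^-1 by rewrite invr_gt0.
have [[n xn]|xout] := in_disc_dec x; last by rewrite !glued_pinch_out.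
apply: set_val_inj.
rewrite (glued_pinchE s0' (glued_pinch_in s0 xn)) (glued_pinchE s0 xn).
by rewrite pinchK.
Qed.

Lemma homeomorphism_glued_pinch s : (forall n, 0 < s n) ->
  homeomorphism (glued_pinch s).
Proof.
move=> s0; have s0' n : 0 < (s n)^-1 by rewrite invr_gt0.
split; first exact: continuous_glued_pinch.
exists (glued_pinch (fun n => (s n)^-1)); split.
- exact: continuous_glued_pinch.
- exact: glued_pinchK.
- move=> x; rewrite -{2}(glued_pinchK s0' x).
  by congr glued_pinch; apply/funext => n; rewrite invrK.
Qed.

End Glue.

(** * The perturbation *)

Section RootsOfUnity.
Variable R : realType.
Implicit Types t r : R.

Definition cis t : R[i] := cos t +i* sin t.

Lemma cisX t n : cis t ^+ n = cis (n%:R * t).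
Proof.
elim: n => [|n IH]; first by rewrite expr0 mul0r /cis cos0 sin0.
rewrite exprSr IH -natr1 mulrDl mul1r /cis cosD sinD.
by rewrite [sin _ * cos _ + _]addrC [X in _ +i* (X + _)]mulrC [_ * cos t]mulrC
  [LHS]mulrC; congr (_ +i* _); ring.
Qed.

Lemma normc_cisB1 t : normc (cis t - 1) <= `|cos t - 1| + `|sin t|.
Proof.
have -> : cis t - 1 = (cos t - 1)%:C + (sin t)%:C * 'i%C.
  by apply/eqP; rewrite eq_complex /=; apply/andP; split; apply/eqP; ring.
apply: le_trans (le_normcD _ _) _; rewrite normcM !normc_real.
by rewrite [normc 'i%C]/= expr0n expr1n add0r sqrtr1 mulr1.
Qed.

Lemma root_unity_near1 (d : nat) r : (1 < d)%N -> 0 < r ->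
  exists k, exists2 w : R[i], w ^+ (d ^ k) = 1 & w != 1 /\ normc (w - 1) < r.
Proof.
move=> hd r0; have r20 : 0 < r / 2 by rewrite divr_gt0.
have near0 (f : R -> R) : continuous f ->
    exists2 e : R, 0 < e & forall t, `|t| < e -> `|f t - f 0| < r / 2.
  move=> /(_ 0) /cvgrPdist_lt /(_ _ r20) /nbhs_ballP[e /= e0 eP].
  exists e => // t te.
  by rewrite distrC; apply: eP; rewrite /ball /= sub0r normrN.
have [e1 e10 cosP] := near0 _ (@continuous_cos R).
have [e2 e20 sinP] := near0 _ (@continuous_sin R).
pose e : R := Num.min e1 e2; have e0 : 0 < e by rewrite lt_min e10.
have pi0 := @pi_gt0 R.
(* With [w = cis (2 * pi / d^k)], a large [k] makes the angle less than [e], while [2 <= k] gives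
   [4 <= d^k], so the angle is below [pi], its sine is positive and [w] differs from 1. *)
pose k := maxn 2 (Num.truncn (2 * pi / e)).+1.
have dk : 2 * pi / e < (d ^ k)%:R.
  apply: lt_trans (truncnS_gt _) _; rewrite ltr_nat.
  by apply: leq_ltn_trans (ltn_expl k hd); rewrite leq_max leqnn orbT.
have dk4 : 4%:R <= (d ^ k)%:R :> R.
  rewrite ler_nat; apply: (@leq_trans (d ^ 2)).
    by rewrite (@leq_exp2r 2 d 2).
  by rewrite leq_pexp2l ?leq_max // ltnW.
have dk0 : 0 < (d ^ k)%:R :> R by apply: lt_le_trans dk4.
pose th : R := 2 * pi / (d ^ k)%:R.
have t0 : 0 < th by rewrite divr_gt0 // mulr_gt0.
have tpi : th < pi.
  rewrite /th ltr_pdivrMr // [2 * pi]mulrC ltr_pM2l //.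
  by apply: lt_le_trans dk4; rewrite ltr_nat.
have te : `|th| < e.
  by rewrite gtr0_norm // /th ltr_pdivrMr // [e * _]mulrC -ltr_pdivrMr.
exists k, (cis th); [|split].
- rewrite cisX /th mulrC divfK ?gt_eqF // /cis.
  by rewrite mulrC mulr_natr cos2pi sin2pi.
- apply/eqP => -[_ st]; have : 0 < sin th by rewrite sin_gt0_pi ?t0.
  by rewrite st ltxx.
- apply: le_lt_trans (normc_cisB1 _) _.
  move: te; rewrite lt_min => /andP[te1 te2].
  by have := cosP _ te1; have := sinP _ te2; rewrite cos0 sin0 subr0; lra.
Qed.

End RootsOfUnity.

(** * The perturbed map along an orbit, and its non-conjugacy to [p] *)

Section Perturbation.
Variables (R : realType) (d : nat) (hd : (1 < d)%N).
Local Notation A := (annulus R).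
Local Notation p := (@power_map R d hd).
Implicit Types x y z : A.

Let d_gt0 : 0 < d%:R :> R. Proof. by rewrite ltr0n ltnW. Qed.

Lemma val_iter_power_map k x :
  set_val (iter k p x) = (set_val x : R[i]) ^+ (d ^ k).
Proof.
elim: k => [|k IH]; first by rewrite expr1.
by rewrite iterS val_power_map [in LHS]IH -exprM expnSr.
Qed.

(** Take [y = w * x] for a root of unity [w] of order dividing [d^k] and close to 1. *)
Lemma power_map_fiber_accum x (r : R) : 0 < r ->
  exists k y, [/\ y <> x, dst y x < r & iter k p y = iter k p x].
Proof.
move=> r0; have [k [w wk [w1 wr]]] := root_unity_near1 hd r0.
have nw : normc w = 1.
  have dk : (0 < d ^ k)%N by rewrite expn_gt0 ltnW.
  apply/eqP; rewrite -(@eqrXn2 _ (d ^ k)) ?normc_ge0 //.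
  by rewrite -normcX wk normc1 expr1n.
have [|y yE] := @annulusP R (w * set_val x).
  by rewrite normcM nw mul1r normc_annulus.
exists k, y; split.
- move=> yx; move: yE; rewrite yx => /esym/eqP.
  rewrite -subr_eq0 -[X in _ - X]mul1r -mulrBl mulf_eq0 subr_eq0 (negPf w1) /=.
  by have := normc_annulus_gt0 x; rewrite normc_gt0 => /negPf ->.
- rewrite /dst yE -[X in _ - X]mul1r -mulrBl normcM; apply: le_lt_trans wr.
  by rewrite ler_piMr ?normc_ge0 ?normc_annulus_le1.
- by apply: set_val_inj; rewrite !val_iter_power_map yE exprMn wk mul1r.
Qed.

(** A conjugacy would carry the nearby points in the fiber through [phi x0] to points near [x0] that
    an iterate of [g] identifies with [x0]. *)
Lemma not_conjugate_to (g : A -> A) (x0 : A) (r : R) : 0 < r ->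
  (forall k x, dst x x0 < r -> iter k g x = iter k g x0 -> x = x0) ->
  ~ conjugate_to p g.
Proof.
move=> r0 g_inj [psi [[psi_cont [phi [_ psiK phiK]]] pg]].
have [e e0 eP] : exists2 e : R, 0 < e &
    forall y, dst y (phi x0) < e -> dst (psi y) (psi (phi x0)) < r.
  exact: (cvg_annulusP _ _).1 (psi_cont _) _ r0.
have [k [y [yx ye pyx]]] := power_map_fiber_accum (phi x0) e0.
have iter_pg n u : psi (iter n p u) = iter n g (psi u).
  by elim: n => // n IH; rewrite !iterS -IH -[LHS]/((psi \o p) _) pg.
apply: yx; apply: (can_inj psiK).
rewrite phiK; apply: (g_inj k); first by have := eP _ ye; rewrite phiK.
by rewrite -iter_pg pyx iter_pg phiK.
Qed.

Lemma halving_sequence (a : nat -> R) : (forall n, 0 < a n) ->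
  (forall n, a n.+1 <= a n / 2) -> forall n m, (n < m)%N -> a m <= a n / 2.
Proof.
move=> a0 ah n; elim=> // m IH; rewrite ltnS leq_eqVlt => /orP[/eqP ->//|/IH am].
by have := ah m; have := a0 m; lra.
Qed.

Variables (c : nat -> A) (b : nat -> R).
Hypothesis c_orbit : forall n, c n.+1 = p (c n).
Hypothesis c0_small : normc (set_val (c 0%N) : R[i]) <= 1 / 2.
Hypothesis b_gt0 : forall n, 0 < b n.
Hypothesis b_small : forall n, b n <= normc (set_val (c n) : R[i]) / 8.
Hypothesis b_inj : forall n, b n <= inj_radius d (c n).

Local Notation a n := (normc (set_val (c n) : R[i])).

Lemma orbit_norm_le n : a n <= 1 / 2.
Proof.
elim: n => // n IH; rewrite c_orbit val_power_map normcX.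
have /andP[a0 a1] := normc_annulus (c n); apply: le_trans IH.
by apply: ler_iXnr; [exact: ltnW | exact: ltW | exact: ltW].
Qed.

(** As [d >= 2], passing to the next point multiplies the modulus by a positive power of itself,
    which is at most 1/2. *)
Lemma orbit_norm_halving n : a n.+1 <= a n / 2.
Proof.
have an := orbit_norm_le n; have /andP[a0 a1] := normc_annulus (c n).
rewrite c_orbit val_power_map normcX; case: d hd => [|[|d']] // _.
rewrite exprS ler_pM2l // -[2^-1]mul1r; apply: le_trans an.
by apply: ler_iXnr; [| exact: ltW | exact: ltW].
Qed.

Lemma orbit_disc_sub n (z : R[i]) :
  normc (z - set_val (c n)) < b n -> 0 < normc z < 1.
Proof.
move=> zc; have an := orbit_norm_le n; have bn := b_small n.
have a0 := normc_annulus_gt0 (c n).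
have := normc_le_sub z (set_val (c n)); have := normc_le_sub (set_val (c n)) z.
rewrite (normcB _ z) => h1 h2.
by apply/andP; split; move: zc an bn a0 h1 h2; lra.
Qed.

Lemma orbit_locally_one_disc x : exists2 r : R, 0 < r &
  forall n m y z, dst y x < r -> dst z x < r ->
  in_disc c b n y -> in_disc c b m z -> n = m.
Proof.
have x0 := normc_annulus_gt0 x.
(* If discs [n < m] were both met, then [|y| > 7/8 a_n], [|z| < 9/8 a_m <= 9/16 a_n] and
   [|y - z| < |x| / 5] would give [|x| > a_n], whereas [|x| < |z| + 3/10 |x|] gives [|x| < a_n]. *)
exists (normc (set_val x : R[i]) / 10); first by rewrite divr_gt0.
move=> n m y z; wlog: n m y z / (n <= m)%N.
  move=> wlg yx zx yn zm; have [nm|mn] := leqP n m.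
    exact: wlg yx zx yn zm.
  exact/esym/(wlg _ _ _ _ (ltnW mn) zx yx zm yn).
rewrite leq_eqVlt => /orP[/eqP//|nm] yx zx yn zm; exfalso.
have am := halving_sequence (fun n => normc_annulus_gt0 (c n))
  orbit_norm_halving nm.
have := b_small n; have := b_small m.
have := normc_le_sub (set_val y) (set_val z).
have := normc_le_sub (set_val x) (set_val y).
have := normc_le_sub (set_val z) (set_val (c m)).
have := normc_le_sub (set_val (c n)) (set_val y).
have := dst_triangle x y z.
move: yx zx yn zm am; rewrite /in_disc.
rewrite (dstC x z) (dstC y (c n)) (dstC y x) /dst.
by move=> *; lra.
Qed.

(** On the half disc the pinch contracts by [2 * s] and [p] expands by at most [d]; this [s] makes
    [d * (2 * s) * (b n / 2)] at most [b n.+1 / 2]. The bound 1 is required by [pinch_half]. *)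
Definition pinch_ratio n : R := Num.min 1 (b n.+1 / (2 * d%:R * b n)).

Lemma pinch_ratio_gt0 n : 0 < pinch_ratio n.
Proof. by rewrite lt_min ltr01 divr_gt0 ?mulr_gt0. Qed.

Let h := glued_pinch c b pinch_ratio.
Let g := p \o h.

Let homeo_h : homeomorphism h.
Proof.
apply: homeomorphism_glued_pinch => //.
- exact: orbit_disc_sub.
- exact: orbit_locally_one_disc.
- exact: pinch_ratio_gt0.
Qed.

Let h_in n x : in_disc c b n x -> in_disc c b n (h x).
Proof.
apply: glued_pinch_in => //.
- exact: orbit_disc_sub.
- exact: orbit_locally_one_disc.
- exact: pinch_ratio_gt0.
Qed.

Let h_out x : (forall n, ~ in_disc c b n x) -> h x = x.
Proof.
apply: glued_pinch_out => //.
- exact: orbit_disc_sub.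
- exact: orbit_locally_one_disc.
- exact: pinch_ratio_gt0.
Qed.

Lemma half_disc_invariant n x : dst x (c n) < b n / 2 ->
  dst (g x) (c n.+1) < b n.+1 / 2.
Proof.
move=> xn; have bn := b_gt0 n.
have xin : in_disc c b n x by rewrite /in_disc; move: xn; lra.
have hx : dst (h x) (c n) <= 2 * pinch_ratio n * dst x (c n).
  rewrite /dst (glued_pinchE b_gt0 orbit_disc_sub orbit_locally_one_disc
    pinch_ratio_gt0 xin).
  by apply: pinch_half => //; rewrite pinch_ratio_gt0 ge_min lexx.
rewrite c_orbit; apply: le_lt_trans (dst_power_map_le _ _ _) _.
have := pinch_ratio_gt0 n.
have : pinch_ratio n * (2 * d%:R * b n) <= b n.+1.
  by rewrite -ler_pdivlMr ?mulr_gt0 // ge_min lexx orbT.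
move: (pinch_ratio n) hx => s hx sb s0.
have h1 : d%:R * dst (h x) (c n) <= d%:R * (2 * s * dst x (c n)).
  by rewrite ler_pM2l.
apply: le_lt_trans h1 _.
have h2 : d%:R * (2 * s * dst x (c n)) < d%:R * (2 * s * (b n / 2)).
  by rewrite ltr_pM2l // ltr_pM2l // mulr_gt0.
apply: lt_le_trans h2 _; move: sb.
have -> : s * (2 * d%:R * b n) = 2 * (d%:R * (2 * s * (b n / 2))) by field.
by lra.
Qed.

(** Induction on [k] for all [n] at once: [g] sends each half disc into the next one, and on disc
    [n] it is the injective [h], which preserves the disc, followed by [p], injective there by
    [b_inj]. *)
Lemma iter_inj_half_disc k n x y : dst x (c n) < b n / 2 ->
  dst y (c n) < b n / 2 -> iter k g x = iter k g y -> x = y.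
Proof.
elim: k n x y => // k IH n x y xn yn; rewrite !iterSr => gxy.
have := IH _ _ _ (half_disc_invariant xn) (half_disc_invariant yn) gxy.
have bn := b_gt0 n; have bi := b_inj n.
have [_ [h' [_ hK _]]] := homeo_h.
have in_d z : dst z (c n) < b n / 2 -> dst (h z) (c n) <= inj_radius d (c n).
  move=> zn; have : in_disc c b n (h z).
    by apply: h_in; rewrite /in_disc; move: zn; lra.
  by rewrite /in_disc => hz; apply: le_trans (ltW hz) bi.
move=> /(power_map_inj_on (in_d _ xn) (in_d _ yn)).
exact: can_inj hK _ _.
Qed.

(** Since [h] preserves the discs, it moves a point of disc [n] by less than the diameter [2 * b n],
    and [p] is [d]-Lipschitz; off the discs [g] equals [p]. *)
Lemma whitney_nbhd_perturbation (eps : A -> R) : (forall x, 0 < eps x) ->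
  (forall n x, in_disc c b n x -> d%:R * (2 * b n) <= eps x) ->
  whitney_nbhd p eps g.
Proof.
move=> eps0 epsb; split.
  exact: covering_map_comp_homeo homeo_h (covering_power_map R hd).
move=> x; rewrite -[ltLHS]/(`|(set_val (g x) : R[i]) - set_val (p x)|).
rewrite normrE_normc ltcR; apply: le_lt_trans (dst_power_map_le hd (h x) x) _.
have [[n xn]|xout] := in_disc_dec c b x; last by rewrite h_out // dstxx mulr0.
apply: lt_le_trans (epsb _ _ xn); rewrite ltr_pM2l //.
have := dst_triangle (c n) (h x) x; rewrite (dstC (c n) x).
by have := h_in xn; move: xn; rewrite /in_disc; lra.
Qed.

Lemma not_conjugate_perturbation : ~ conjugate_to p g.
Proof.
apply: (@not_conjugate_to g (c 0%N) (b 0%N / 2)); first by rewrite divr_gt0.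
move=> k x xc; apply: iter_inj_half_disc xc _.
by rewrite dstxx divr_gt0.
Qed.

End Perturbation.

Theorem theorem3 (R : realType) (d : nat) (hd : (1 < d)%N) :
  ~ C0W_stable (@power_map R d hd).
Proof.
move=> [eps [ceps eps0 stable]].
have d0 : 0 < d%:R :> R by rewrite ltr0n ltnW.
(* Starting at modulus 1/2 makes the moduli along the orbit at least halve at each step. *)
have [|c0 c0E] := @annulusP R (1 / 2 : R)%:C.
  by rewrite normc_real gtr0_norm; lra.
pose c n := iter n (@power_map R d hd) c0.
have /choice[b bP] : forall n, exists b : R,
    [/\ 0 < b, b <= normc (set_val (c n) : R[i]) / 8,
        b <= inj_radius d (c n) &
        forall x, dst x (c n) < b -> d%:R * (2 * b) <= eps x].
  move=> n; have en := eps0 (c n).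
  have en2 : 0 < eps (c n) / 2 by rewrite divr_gt0.
  have [r r0 rP] := continuous_annulus_real (ceps (c n)) en2.
  (* The first two bounds are [b_small] and [b_inj]; [r] keeps [eps] above [eps (c n) / 2] on the
     disc, and the last bound makes [2 * d * b] at most that value. *)
  pose b := Num.min
    (Num.min (normc (set_val (c n) : R[i]) / 8) (inj_radius d (c n)))
    (Num.min r (eps (c n) / (4 * d%:R))).
  exists b; split.
  - rewrite !lt_min r0 inj_radius_gt0 //= !divr_gt0 ?mulr_gt0 //.
    exact: normc_annulus_gt0.
  - by rewrite /b !ge_min lexx.
  - by rewrite /b !ge_min lexx orbT.
  - move=> x; rewrite lt_min => /andP[_]; rewrite lt_min => /andP[/rP xr _].
    have : b <= eps (c n) / (4 * d%:R) by rewrite /b !ge_min lexx !orbT.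
    rewrite ler_pdivlMr ?mulr_gt0 // => h.
    have := ler_norm (eps (c n) - eps x).
    by rewrite [d%:R * _]mulrA [d%:R * 2]mulrC mulrC; move: h; lra.
have b_gt0 n : 0 < b n by have [] := bP n.
have b_small n : b n <= normc (set_val (c n) : R[i]) / 8 by have [] := bP n.
have b_inj n : b n <= inj_radius d (c n) by have [] := bP n.
have c_orbit n : c n.+1 = power_map hd (c n) by [].
have c0_small : normc (set_val (c 0%N) : R[i]) <= 1 / 2.
  by rewrite c0E normc_real gtr0_norm; lra.
apply: (not_conjugate_perturbation c_orbit c0_small b_gt0 b_small b_inj).
apply: stable; apply: whitney_nbhd_perturbation => // n x.
by have [_ _ _] := bP n; apply.
Qed.
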